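(* Let $\chi$ be a nonprincipal primitive Dirichlet character whose conductor $f_\chi$ is odd, let $r$ be a positive integer and let $b$ be real with $0\le b<r$. For $\theta>0$ set $$G_{1,\chi}(\theta,b,r)=r\sum_{n=0}^\infty(-1)^n\chi(n)e^{-(n+b/r)^r\theta}.$$ Then for any nonnegative integer $N$, $$G_{1,\chi}(\theta,b,r)=\frac r2\sum_{n=0}^{N}(-1)^{n}\frac{E_{rn,\bar\chi}\left(\frac br\right)}{n!}\,\theta^n+O(\theta^{N+1})\qquad\text{as }\theta\to0^+.$$
   Context: The principal character $\chi^0$ is the one with conductor $1$, i.e. $\chi^0(m)=1$ for all integers $m$; ''nonprincipal'' means $\chi\ne\chi^0$. A primitive character $\chi$ modulo $f_\chi$ is regarded as a function on $\mathbb Z$, periodic mod $f_\chi$ and zero on integers not coprime to $f_\chi$; $\bar\chi$ is its complex conjugate. For a primitive character $\chi$ modulo an odd $f_\chi>1$, the generalized Euler polynomials $E_{n,\chi}(x)$ are defined by (note the conjugate) $$\sum_{m=0}^{f_\chi-1}\frac{2(-1)^m\bar\chi(m)\,e^{(m+x)t}}{e^{f_\chi t}+1}=\sum_{n=0}^\infty E_{n,\chi}(x)\frac{t^n}{n!}\qquad(|t|<\pi/f_\chi).$$ Thus $E_{n,\bar\chi}(x)$ is given by the same generating function with $\chi(m)$ in place of $\bar\chi(m)$. The implied constant in $O(\theta^{N+1})$ may depend on $N,\chi,b,r$. *)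

(* Defs.v *)
From Stdlib Require Export Reals ZArith Arith.
From Coquelicot Require Export Coquelicot.

Open Scope R_scope.

Record dirichlet_char (f : nat) (chi : Z -> C) : Prop := {
  dchar_pos : (0 < f)%nat;
  dchar_periodic : forall m : Z, chi (m + Z.of_nat f)%Z = chi m;
  dchar_support : forall m : Z, chi m <> 0%C <-> Z.gcd m (Z.of_nat f) = 1%Z;
  dchar_one : chi 1%Z = 1%C;
  dchar_mult : forall m n : Z, chi (m * n)%Z = (chi m * chi n)%C
}.

(* [chi] modulo [f] is induced by [psi] modulo [d]: both agree on the integers
   prime to [f], and [chi] vanishes on the others by [dchar_support]. *)
Definition induced_from (f : nat) (chi : Z -> C) (d : nat) : Prop :=
  exists psi : Z -> C, dirichlet_char d psi /\
    forall m : Z, Z.gcd m (Z.of_nat f) = 1%Z -> chi m = psi m.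

(* The conductor of such a [chi] is [f] itself. *)
Definition primitive_char (f : nat) (chi : Z -> C) : Prop :=
  dirichlet_char f chi /\
  forall d : nat, Nat.divide d f -> (d < f)%nat -> ~ induced_from f chi d.

Definition principal_char : Z -> C := fun _ => 1%C.

Definition nonprincipal (chi : Z -> C) : Prop :=
  ~ (forall m : Z, chi m = principal_char m).

Definition conj_char (chi : Z -> C) : Z -> C := fun m => Cconj (chi m).

Definition Cexp (z : C) : C :=
  (RtoC (exp (Re z)) * (cos (Im z), sin (Im z)))%C.

(* Unspecified when the series diverges. *)
Definition CSeries (a : nat -> C) : C :=
  iota (fun l : C_CompleteNormedModule => is_series a l).

(* The conjugate of [chi] enters the sum, so the generating function of
   [E_{n, conj chi}] is the one with [chi] itself in the sum. *)
Definition gen_euler_gf (f : nat) (chi : Z -> C) (x : R) (t : C) : C :=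
  sum_n_m (fun m : nat =>
    (2 * RtoC ((-1) ^ m) * conj_char chi (Z.of_nat m)
       * Cexp ((RtoC (INR m) + RtoC x) * t)
     / (Cexp (RtoC (INR f) * t) + 1))%C) 0 (f - 1).

(* [E n x] is the value [E_{n, chi}(x)]: the expansion on the complex disc
   [|t| < PI / f] determines [E] uniquely. *)
Definition gen_euler_poly (f : nat) (chi : Z -> C) (E : nat -> R -> C) : Prop :=
  forall (x : R) (t : C), Cmod t < PI / INR f ->
    @is_pseries C_AbsRing C_NormedModule
      (fun n : nat => (E n x / RtoC (INR (fact n)))%C) t
      (gen_euler_gf f chi x t).

Definition G1 (chi : Z -> C) (theta b : R) (r : nat) : C :=
  (RtoC (INR r) *
   CSeries (fun n : nat =>
     (RtoC ((-1) ^ n) * chi (Z.of_nat n)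
      * RtoC (exp (- ((INR n + b / INR r) ^ r * theta))))%C))%C.

(* Main.v *)
Require Import Defs.
From Stdlib Require Import Lra Lia List.
Import ListNotations.

(* Put [a n = (-1)^n chi n], [x = b/r] and [phi u = exp (- u^r theta)].  As [f] is
   odd, [a (n + f) = - a n], so if [Phi u + Phi (u + f) = phi u - rho u] then the
   series of [a n * phi (n + x)] telescopes to the sum of [a m * Phi (m + x)] over
   [m < f], up to the series of [a n * rho (n + x)].  Euler's transformation of the
   alternating series provides such a [Phi], a finite combination of translates of
   [phi], with [rho] a [J]-th difference; for [J = r (N + 1) + 2] the mean value
   theorem makes [rho] of size [theta^(N+1) / (1 + u)^2].  Expanding [phi] in powers
   of [theta] inside the finite sum leaves the same combinations of the monomials
   [u^(r n)].  These are [E_{rn} / 2], as one sees by applying the transformation to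
   [u |-> exp (u t)], which reproduces half the generating function up to [O(t^J)]. *)

(** * Orders of magnitude as the variable tends to zero from the right *)

Definition bigO (p : nat) (F : R -> R) : Prop :=
  exists K : R, at_right 0 (fun t => Rabs (F t) <= K * t ^ p).

Lemma at_right_0_lt (d : R) : 0 < d -> at_right 0 (fun t => 0 < t < d).
Proof.
  intros Hd. exists (mkposreal d Hd). intros t Ht Ht0.
  change (Rabs (t - 0) < d) in Ht. apply Rabs_def2 in Ht. lra.
Qed.

Lemma bigO_ext_near (p : nat) (F G : R -> R) :
  at_right 0 (fun t => F t = G t) -> bigO p F -> bigO p G.
Proof.
  intros HFG [K HK]. exists K.
  generalize (filter_and _ _ HFG HK). apply filter_imp.
  intros t [<- H]. exact H.
Qed.

Lemma bigO_ext (p : nat) (F G : R -> R) :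
  (forall t, F t = G t) -> bigO p F -> bigO p G.
Proof.
  intros HFG. apply bigO_ext_near. exists (mkposreal 1 Rlt_0_1). auto.
Qed.

Lemma bigO_zero (p : nat) : bigO p (fun _ => 0).
Proof.
  exists 0. exists (mkposreal 1 Rlt_0_1). intros t _ _. rewrite Rabs_R0. lra.
Qed.

Lemma bigO_const (c : R) : bigO 0 (fun _ => c).
Proof.
  exists (Rabs c). exists (mkposreal 1 Rlt_0_1). intros t _ _. simpl. lra.
Qed.

Lemma bigO_plus (p : nat) (F G : R -> R) :
  bigO p F -> bigO p G -> bigO p (fun t => F t + G t).
Proof.
  intros [K HK] [L HL]. exists (K + L).
  generalize (filter_and _ _ HK HL). apply filter_imp.
  intros t [H1 H2]. pose proof (Rabs_triang (F t) (G t)). lra.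
Qed.

Lemma bigO_mult (p q : nat) (F G : R -> R) :
  bigO p F -> bigO q G -> bigO (p + q) (fun t => F t * G t).
Proof.
  intros [K HK] [L HL]. exists (K * L).
  generalize (filter_and _ _ HK HL). apply filter_imp.
  intros t [H1 H2]. rewrite Rabs_mult, pow_add.
  replace (K * L * (t ^ p * t ^ q)) with (K * t ^ p * (L * t ^ q)) by ring.
  apply Rmult_le_compat; auto using Rabs_pos.
Qed.

Lemma bigO_scal (p : nat) (c : R) (F : R -> R) :
  bigO p F -> bigO p (fun t => c * F t).
Proof. exact (bigO_mult 0 p _ F (bigO_const c)). Qed.

Lemma bigO_minus (p : nat) (F G : R -> R) :
  bigO p F -> bigO p G -> bigO p (fun t => F t - G t).
Proof.
  intros HF HG. apply bigO_ext with (fun t => F t + (-1) * G t).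
  - intros t. ring.
  - apply bigO_plus; [exact HF | now apply bigO_scal].
Qed.

Lemma bigO_pow (p J : nat) (F : R -> R) :
  bigO p F -> bigO (J * p) (fun t => F t ^ J).
Proof.
  intros HF. induction J as [|J IH].
  - exact (bigO_const 1).
  - exact (bigO_mult p (J * p) F _ HF IH).
Qed.

Lemma bigO_sum (p N : nat) (F : nat -> R -> R) :
  (forall k, bigO p (F k)) -> bigO p (fun t => sum_f_R0 (fun k => F k t) N).
Proof.
  intros HF. induction N as [|N IH]; simpl.
  - apply HF.
  - apply bigO_plus; auto.
Qed.

Lemma pow_bigO (p : nat) : bigO p (fun t => t ^ p).
Proof.
  exists 1. generalize (at_right_0_lt 1 Rlt_0_1). apply filter_imp.
  intros t Ht. rewrite Rabs_pos_eq; [lra | apply pow_le; lra].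
Qed.

Lemma bigO_weaken (p q : nat) (F : R -> R) : (q <= p)%nat -> bigO p F -> bigO q F.
Proof.
  intros Hqp [K HK]. exists (Rabs K).
  generalize (filter_and _ _ HK (at_right_0_lt 1 Rlt_0_1)). apply filter_imp.
  intros t [H Ht]. eapply Rle_trans; [exact H|].
  apply Rle_trans with (Rabs K * t ^ p).
  - apply Rmult_le_compat_r; [apply pow_le; lra | apply Rle_abs].
  - apply Rmult_le_compat_l; [apply Rabs_pos|].
    replace p with (q + (p - q))%nat by lia. rewrite pow_add.
    rewrite <- (Rmult_1_r (t ^ q)) at 2.
    apply Rmult_le_compat_l; [apply pow_le; lra|].
    rewrite <- (pow1 (p - q)). apply pow_incr. lra.
Qed.

(** * Taylor remainders and uniqueness of polynomial expansions *)

(** Dropping the first [N + 1] terms leaves [t ^ S N] times a power series. Its terms at [d / 2] are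
    bounded, so its radius of convergence is positive; its sum is then continuous at 0, hence
    bounded nearby. *)
Lemma pseries_remainder (a : nat -> R) (h : R -> R) (d : R) (N : nat) :
  0 < d ->
  (forall t, Rabs t < d -> is_pseries a t (h t)) ->
  bigO (S N) (fun t => h t - sum_f_R0 (fun k => a k * t ^ k) N).
Proof.
  intros Hd Ha.
  set (g := PSeries (PS_decr_n a (S N))).
  assert (Hrad : Rbar_lt (Rabs 0) (CV_radius (PS_decr_n a (S N)))).
  { apply Rbar_lt_le_trans with (d / 2).
    - rewrite Rabs_R0. simpl. lra.
    - destruct (CV_radius_bounded (PS_decr_n a (S N))) as [Hub _]. apply Hub.
      assert (Hex : ex_pseries (PS_decr_n a (S N)) (d / 2)).
      { eexists. apply (is_pseries_decr_n a (S N) (d / 2) (/ (d / 2))).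
        - change (/ (d / 2) * (d / 2) = 1). field. lra.
        - lia.
        - apply Ha. rewrite Rabs_pos_eq; lra. }
      apply ex_series_lim_0 in Hex.
      apply (is_lim_seq_ext _ (fun n => PS_decr_n a (S N) n * (d / 2) ^ n)) in Hex.
      2:{ intros n. rewrite pow_n_pow. apply Rmult_comm. }
      apply is_lim_seq_Reals in Hex.
      destruct (maj_by_pos _ (exist _ 0 Hex)) as [M [_ HM]].
      exists M. exact HM. }
  pose proof (PSeries_continuity _ 0 Hrad) as Hc.
  apply continuity_pt_locally with (eps := mkposreal 1 Rlt_0_1) in Hc.
  exists (Rabs (g 0) + 1).
  assert (Hc' : at_right 0 (fun t => Rabs (g t - g 0) < 1))
    by (apply filter_le_within; exact Hc).
  generalize (filter_and _ _ Hc' (at_right_0_lt d Hd)). apply filter_imp.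
  intros t [H Ht].
  pose proof (Ha t ltac:(rewrite Rabs_pos_eq; lra)) as Hs.
  rewrite <- (is_pseries_unique _ _ _ Hs).
  rewrite (PSeries_decr_n a N t) by (eexists; exact Hs).
  fold g.
  replace (_ + _ - _) with (t ^ S N * g t) by ring.
  rewrite Rabs_mult, (Rabs_pos_eq (t ^ S N)) by (apply pow_le; lra).
  rewrite Rmult_comm. apply Rmult_le_compat_r; [apply pow_le; lra|].
  pose proof (Rabs_triang (g t - g 0) (g 0)).
  replace (g t - g 0 + g 0) with (g t) in * by ring. lra.
Qed.

Lemma exp_remainder (c : R) (N : nat) :
  bigO (S N) (fun t => exp (c * t) - sum_f_R0 (fun k => c ^ k / INR (fact k) * t ^ k) N).
Proof.
  apply pseries_remainder with 1; [lra|]. intros t _.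
  generalize (is_exp_Reals (c * t)). apply is_series_ext.
  intros n. rewrite !pow_n_pow.
  change ((c * t) ^ n * / INR (fact n) = t ^ n * (c ^ n / INR (fact n))).
  rewrite Rpow_mult_distr. field. apply INR_fact_neq_0.
Qed.

(** The coefficients are peeled off from the lowest: the constant term is O(t), hence zero, and
    division by [t] reduces the degree. *)
Lemma bigO_poly_coef (J : nat) : forall d : nat -> R,
  bigO (S J) (fun t => sum_f_R0 (fun k => d k * t ^ k) J) ->
  forall k, (k <= J)%nat -> d k = 0.
Proof.
  (* If |c| <= K t near zero, any such t below |c| / (|K| + 1) gives a contradiction. *)
  assert (Hconst : forall c, bigO 1 (fun _ => c) -> c = 0).
  { intros c [K HK].
    destruct (Req_dec c 0) as [|Hc]; [assumption|exfalso].
    pose proof (Rabs_pos_lt c Hc) as Hc'.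
    assert (HKp : 0 < Rabs K + 1) by (pose proof (Rabs_pos K); lra).
    pose proof (at_right_0_lt (Rabs c / (Rabs K + 1)) ltac:(apply Rdiv_lt_0_compat; lra)) as Hs.
    destruct (filter_ex _ (filter_and _ _ HK Hs)) as [t [H [Ht0 Ht]]].
    apply (Rmult_lt_compat_r (Rabs K + 1)) in Ht; [|lra].
    replace (Rabs c / (Rabs K + 1) * (Rabs K + 1)) with (Rabs c) in Ht by (field; lra).
    pose proof (Rle_abs K). nra. }
  induction J as [|J IH]; intros d Hd.
  - intros k Hk. replace k with 0%nat by lia. apply Hconst.
    apply bigO_ext with (2 := Hd). intros t. simpl. ring.
  - assert (Hsplit : forall t, sum_f_R0 (fun k => d k * t ^ k) (S J)
        = d 0%nat + t * sum_f_R0 (fun k => d (S k) * t ^ k) J).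
    { intros t. rewrite decomp_sum by lia. simpl pred. rewrite scal_sum.
      simpl (t ^ 0). rewrite Rmult_1_r. f_equal.
      apply sum_eq. intros i _. simpl. ring. }
    assert (H0 : d 0%nat = 0).
    { apply Hconst.
      (* The constant term is the polynomial minus its terms of positive degree, and all of these
         are O(t). *)
      apply bigO_ext with (fun t => sum_f_R0 (fun k => d k * t ^ k) (S J)
         - sum_f_R0 (fun k => d (S k) * t ^ S k) J).
      - intros t. rewrite Hsplit, scal_sum.
        rewrite (sum_eq (fun k => d (S k) * t ^ S k) (fun k => d (S k) * t ^ k * t)).
        + ring.
        + intros i _. simpl. ring.
      - apply bigO_minus.
        + apply bigO_weaken with (2 := Hd). lia.
        + apply bigO_sum. intros k. apply bigO_scal.
          apply bigO_weaken with (S k); [lia | apply pow_bigO]. }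
    assert (HS : forall k, (k <= J)%nat -> d (S k) = 0).
    { apply (IH (fun k => d (S k))). destruct Hd as [K HK]. exists K.
      generalize (filter_and _ _ HK (at_right_0_lt 1 Rlt_0_1)). apply filter_imp.
      intros t [H Ht]. rewrite Hsplit, H0, Rplus_0_l, Rabs_mult, (Rabs_pos_eq t) in H by lra.
      apply Rmult_le_reg_l with t; [lra|]. eapply Rle_trans; [exact H|].
      simpl. right. ring. }
    intros [|k] Hk; [exact H0 | apply HS; lia].
Qed.

(** * Iterated half differences and Euler's transformation *)

(** This is the operator [D ^ j] with [D = (1 - T) / 2], where [T] is translation by [h]. *)
Fixpoint half_diff (h : R) (j : nat) (F : R -> R) (u : R) : R :=
  match j with
  | O => F u
  | S i => (half_diff h i F u - half_diff h i F (u + h)) / 2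
  end.

(* Euler's transformation of [F u - F (u + h) + F (u + 2 h) - ...], truncated. *)
Fixpoint euler_sum (h : R) (J : nat) (F : R -> R) (u : R) : R :=
  match J with
  | O => 0
  | S i => euler_sum h i F u + half_diff h i F u / 2
  end.

(** In operator form [euler_sum] is half the geometric sum of the [D ^ i] for [i < J], and
    [1 + T = 2 (1 - D)]; the product is [1 - D ^ J]. *)
Lemma euler_sum_shift (h : R) (J : nat) (F : R -> R) (u : R) :
  euler_sum h J F u + euler_sum h J F (u + h) = F u - half_diff h J F u.
Proof. induction J as [|J IH]; simpl; lra. Qed.

Lemma half_diff_minus (h : R) (j : nat) (F G : R -> R) (u : R) :
  half_diff h j (fun v => F v - G v) u = half_diff h j F u - half_diff h j G u.
Proof.
  revert u. induction j as [|j IH]; intros u; simpl; [|rewrite !IH]; lra.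
Qed.

Lemma euler_sum_minus (h : R) (J : nat) (F G : R -> R) (u : R) :
  euler_sum h J (fun v => F v - G v) u = euler_sum h J F u - euler_sum h J G u.
Proof.
  induction J as [|J IH]; simpl; [|rewrite IH, half_diff_minus]; lra.
Qed.

Lemma half_diff_sum (h : R) (j : nat) (c : nat -> R) (G : nat -> R -> R) (N : nat) (u : R) :
  half_diff h j (fun v => sum_f_R0 (fun k => c k * G k v) N) u
  = sum_f_R0 (fun k => c k * half_diff h j (G k) u) N.
Proof.
  revert u. induction j as [|j IH]; intros u; simpl; [reflexivity|].
  rewrite !IH, <- minus_sum. unfold Rdiv. rewrite Rmult_comm, scal_sum.
  apply sum_eq. intros i _. ring.
Qed.

Lemma euler_sum_sum (h : R) (J : nat) (c : nat -> R) (G : nat -> R -> R) (N : nat) (u : R) :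
  euler_sum h J (fun v => sum_f_R0 (fun k => c k * G k v) N) u
  = sum_f_R0 (fun k => c k * euler_sum h J (G k) u) N.
Proof.
  induction J as [|J IH]; simpl.
  - rewrite (sum_eq _ (fun _ => 0)); [now rewrite sum_eq_R0 |intros; ring].
  - rewrite IH, half_diff_sum. unfold Rdiv. rewrite (Rmult_comm _ (/ 2)), scal_sum, <- plus_sum.
    apply sum_eq. intros i _. ring.
Qed.

(** Only finitely many translates enter, so a bound at each fixed [u] suffices, with a constant that
    may depend on [u]. *)
Lemma half_diff_bigO (h : R) (j p : nat) (G : R -> R -> R) :
  (forall u, bigO p (fun t => G t u)) ->
  forall u, bigO p (fun t => half_diff h j (G t) u).
Proof.
  intros HG. induction j as [|j IH]; intros u; simpl; [apply HG|].
  apply bigO_ext with (fun t => / 2 * (half_diff h j (G t) u - half_diff h j (G t) (u + h))).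
  - intros t. field.
  - apply bigO_scal, bigO_minus; apply IH.
Qed.

Lemma euler_sum_bigO (h : R) (J p : nat) (G : R -> R -> R) :
  (forall u, bigO p (fun t => G t u)) ->
  forall u, bigO p (fun t => euler_sum h J (G t) u).
Proof.
  intros HG u. induction J as [|J IH]; simpl; [apply bigO_zero|].
  apply bigO_plus; [exact IH|].
  apply bigO_ext with (fun t => / 2 * half_diff h J (G t) u).
  - intros t. field.
  - now apply bigO_scal, half_diff_bigO.
Qed.

Lemma half_diff_exp (h t : R) (j : nat) (u : R) :
  half_diff h j (fun v => exp (v * t)) u = exp (u * t) * ((1 - exp (h * t)) / 2) ^ j.
Proof.
  revert u. induction j as [|j IH]; intros u; simpl; [ring|].
  rewrite !IH, Rmult_plus_distr_r, exp_plus. field.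
Qed.

(** Exponentials are eigenfunctions of [T], so this is a geometric sum of ratio
    [w = (1 - exp (h t)) / 2], with [1 - w = (exp (h t) + 1) / 2]. The factor in front of
    [1 - w ^ J] is, up to its coefficient, half a term of the Euler generating function. *)
Lemma euler_sum_exp (h t : R) (J : nat) (u : R) :
  euler_sum h J (fun v => exp (v * t)) u
  = exp (u * t) / (exp (h * t) + 1) * (1 - ((1 - exp (h * t)) / 2) ^ J).
Proof.
  pose proof (exp_pos (h * t)).
  induction J as [|J IH]; simpl.
  - ring.
  - rewrite IH, half_diff_exp. field. lra.
Qed.

Lemma half_diff_lim (h : R) (j : nat) (F : R -> R) :
  (forall u, is_lim_seq (fun n => F (INR n + u)) 0) ->
  forall u, is_lim_seq (fun n => half_diff h j F (INR n + u)) 0.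
Proof.
  intros HF. induction j as [|j IH]; intros u; simpl; [apply HF|].
  replace (Finite 0) with (Rbar_mult (Finite (0 - 0)) (/ 2)) by (simpl; f_equal; ring).
  apply is_lim_seq_scal_r, is_lim_seq_minus'; [apply IH|].
  apply is_lim_seq_ext with (2 := IH (u + h)). intros n. now rewrite Rplus_assoc.
Qed.

Lemma euler_sum_lim (h : R) (J : nat) (F : R -> R) :
  (forall u, is_lim_seq (fun n => F (INR n + u)) 0) ->
  forall u, is_lim_seq (fun n => euler_sum h J F (INR n + u)) 0.
Proof.
  intros HF u. induction J as [|J IH]; simpl.
  - apply is_lim_seq_const.
  - replace (Finite 0) with (Finite (0 + 0 * / 2)) by (f_equal; ring).
    apply is_lim_seq_plus'; [exact IH|].
    apply (is_lim_seq_scal_r _ (/ 2) 0). now apply half_diff_lim.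
Qed.

Lemma half_diff_derive (h : R) (j : nat) (F F' : R -> R) :
  (forall u, is_derive F u (F' u)) ->
  forall u, is_derive (half_diff h j F) u (half_diff h j F' u).
Proof.
  intros HF. induction j as [|j IH]; intros u; simpl; [apply HF|].
  assert (Hex : forall v, ex_derive (half_diff h j F) v) by (intros v; eexists; apply IH).
  assert (HD : forall v, Derive (half_diff h j F) v = half_diff h j F' v)
    by (intros v; apply is_derive_unique, IH).
  auto_derive; [auto|].
  change (fun x => half_diff h j F x) with (half_diff h j F). rewrite !HD. field.
Qed.

(** Here [g] lists a function with its successive derivatives. By the mean value theorem each half
    difference costs a factor [h / 2] and one derivative. The intermediate points lie to the right
    of [u], whence the bound on a half-line. *)
Lemma half_diff_bound (h : R) (g : nat -> R -> R) :
  0 < h ->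
  (forall i u, is_derive (g i) u (g (S i) u)) ->
  forall J i u M, (forall v, u <= v -> Rabs (g (i + J)%nat v) <= M) ->
  Rabs (half_diff h J (g i) u) <= (h / 2) ^ J * M.
Proof.
  intros Hh Hg J. induction J as [|J IH]; intros i u M HM; simpl.
  - rewrite Rmult_1_l, <- (Nat.add_0_r i). apply HM. lra.
  - assert (Hb : Rabs (half_diff h J (g i) (u + h) - half_diff h J (g i) u)
        <= (h / 2) ^ J * M * h).
    { destruct (MVT_gen (half_diff h J (g i)) u (u + h) (half_diff h J (g (S i))))
        as [c [Hc ->]].
      - intros x _. apply half_diff_derive, Hg.
      - intros x _. apply derivable_continuous_pt. eexists.
        apply is_derive_Reals. now apply half_diff_derive.
      - rewrite Rmin_left in Hc by lra.
        rewrite Rabs_mult. replace (u + h - u) with h by ring.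
        rewrite (Rabs_pos_eq h) by lra. apply Rmult_le_compat_r; [lra|].
        apply IH. intros v Hv. replace (S i + J)%nat with (i + S J)%nat by lia.
        apply HM. lra. }
    unfold Rdiv at 1. rewrite Rabs_mult, Rabs_minus_sym, (Rabs_pos_eq (/ 2)) by lra. lra.
Qed.

(** * Euler's transformation of monomials and the generating function *)

Lemma sum_f_R0_swap (F : nat -> nat -> R) (m n : nat) :
  sum_f_R0 (fun i => sum_f_R0 (F i) n) m
  = sum_f_R0 (fun j => sum_f_R0 (fun i => F i j) m) n.
Proof.
  induction m as [|m IH]; simpl; [reflexivity|].
  now rewrite IH, <- plus_sum.
Qed.

(** The generating function of the generalized Euler polynomials at real [t], with [a m] for the
    signed character value and [S f'] for the conductor. *)
Definition alt_gf (a : nat -> R) (f' : nat) (x t : R) : R :=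
  sum_f_R0 (fun m => 2 * a m * exp ((INR m + x) * t) / (exp (INR (S f') * t) + 1)) f'.

(** The transformation of [exp (v t)] is expanded in [t] in two ways: termwise, giving its values on
    monomials, and in closed form, giving half the generating function. Both are valid up to
    O(t^(J+1)), so the coefficients through degree [J] agree. *)
Lemma euler_sum_coef (f' J p : nat) (x d : R) (a e : nat -> R) :
  0 < d ->
  (forall t, Rabs t < d ->
     is_pseries (fun n => e n / INR (fact n)) t (alt_gf a f' x t)) ->
  (p <= J)%nat ->
  sum_f_R0 (fun m => a m * euler_sum (INR (S f')) (S J) (fun v => v ^ p) (INR m + x)) f'
  = e p / 2.
Proof.
  intros Hd He Hp. set (h := INR (S f')).
  set (L := fun k => sum_f_R0 (fun m => a m * euler_sum h (S J) (fun v => v ^ k) (INR m + x)) f').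
  change (L p = e p / 2).
  set (w := fun t => (1 - exp (h * t)) / 2).
  set (F := fun t => sum_f_R0
     (fun m => a m * euler_sum h (S J) (fun v => exp (v * t)) (INR m + x)) f').
  assert (H1 : bigO (S J) (fun t => / 2 *
      (alt_gf a f' x t - sum_f_R0 (fun k => e k / INR (fact k) * t ^ k) J))).
  { apply bigO_scal, pseries_remainder with d; assumption. }
  (* Termwise expansion: by linearity, [exp (v t)] may be replaced by its Taylor polynomial inside
     the transformation. *)
  assert (H2 : bigO (S J) (fun t => F t - sum_f_R0 (fun k => L k / INR (fact k) * t ^ k) J)).
  { apply bigO_ext with (fun t => sum_f_R0 (fun m => a m *
        euler_sum h (S J) (fun v => exp (v * t)
           - sum_f_R0 (fun k => t ^ k / INR (fact k) * v ^ k) J) (INR m + x)) f').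
    - intros t. unfold F.
      rewrite (sum_eq (fun k => L k / INR (fact k) * t ^ k)
        (fun k => sum_f_R0 (fun m => a m * (t ^ k / INR (fact k)
            * euler_sum h (S J) (fun v => v ^ k) (INR m + x))) f')).
      + rewrite <- (sum_f_R0_swap (fun m k => a m * (t ^ k / INR (fact k)
            * euler_sum h (S J) (fun v => v ^ k) (INR m + x)))), <- minus_sum.
        apply sum_eq. intros m _.
        rewrite euler_sum_minus, (euler_sum_sum h (S J) (fun k => t ^ k / INR (fact k))),
          Rmult_minus_distr_l.
        f_equal. rewrite scal_sum. apply sum_eq. intros k _. ring.
      + intros k _. unfold L, Rdiv. rewrite Rmult_assoc, Rmult_comm, scal_sum.
        apply sum_eq. intros m _. ring.
    - apply bigO_sum. intros m. apply bigO_scal.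
      apply (euler_sum_bigO h (S J) (S J) (fun t v => exp (v * t)
           - sum_f_R0 (fun k => t ^ k / INR (fact k) * v ^ k) J)).
      intros v. apply bigO_ext with (2 := exp_remainder v J). intros t. f_equal.
      apply sum_eq. intros k _. unfold Rdiv. ring. }
  (* [w] vanishes at 0, so it is O(t). *)
  assert (Hw : bigO (S J) (fun t => w t ^ S J)).
  { replace (S J) with (S J * 1)%nat at 1 by lia. apply bigO_pow.
    apply bigO_ext with (2 := bigO_scal _ (- / 2) _ (exp_remainder h 0)).
    intros t. unfold w. simpl. field. }
  (* Closed form: the discrepancy is exactly half of [alt_gf] times [w t ^ S J], and [alt_gf] is
     bounded near 0. *)
  assert (H3 : bigO (S J) (fun t => / 2 * alt_gf a f' x t - F t)).
  { apply bigO_ext with (fun t => / 2 * (alt_gf a f' x t * w t ^ S J)).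
    - intros t. unfold alt_gf, F. rewrite <- Rmult_assoc, !scal_sum.
      rewrite (Rmult_comm _ (w t ^ S J)), scal_sum, <- minus_sum.
      apply sum_eq. intros m _. rewrite euler_sum_exp. fold (w t). fold h.
      field. pose proof (exp_pos (h * t)). lra.
    - apply bigO_scal, (bigO_mult 0 (S J)); [|exact Hw].
      apply bigO_ext with (fun t => (alt_gf a f' x t
          - sum_f_R0 (fun k => e k / INR (fact k) * t ^ k) 0) + e 0%nat).
      + intros t. simpl. field.
      + apply bigO_plus; [|apply bigO_const].
        apply bigO_weaken with 1%nat; [lia|]. now apply pseries_remainder with d. }
  assert (H4 : (L p - e p / 2) / INR (fact p) = 0).
  { apply (bigO_poly_coef J (fun k => (L k - e k / 2) / INR (fact k))); [|exact Hp].
    (* In [H1 - H2 - H3] both [F] and [alt_gf] cancel, leaving a polynomial in [t]. *)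
    apply bigO_ext with (2 := bigO_minus _ _ _ (bigO_minus _ _ _ H1 H2) H3). intros t.
    rewrite (sum_eq (fun k => (L k - e k / 2) / INR (fact k) * t ^ k)
       (fun k => L k / INR (fact k) * t ^ k - e k / INR (fact k) * t ^ k * / 2)).
    - rewrite minus_sum, <- scal_sum. ring.
    - intros k _. field. apply INR_fact_neq_0. }
  apply Rmult_integral in H4. destruct H4 as [H4|H4].
  - lra.
  - exfalso. revert H4. apply Rinv_neq_0_compat, INR_fact_neq_0.
Qed.

(** * Decay of the derivatives of the exponential of a power *)

(* [(c, i, p)] encodes the monomial [c * theta ^ i * u ^ p]. *)
Definition eval_monos (l : list (R * nat * nat)) (theta u : R) : R :=
  fold_right (fun '(c, i, p) s => c * theta ^ i * u ^ p + s) 0 l.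

(** Product rule for a monomial times [exp (- (u ^ r * theta))]: the first entry differentiates the
    power of [u], the second the exponential. *)
Definition derive_monos (r : nat) (l : list (R * nat * nat)) : list (R * nat * nat) :=
  flat_map (fun '(c, i, p) =>
    [(c * INR p, i, pred p); (- c * INR r, S i, (p + pred r)%nat)]) l.

(** The [j]-th derivative in [u] of [exp (- (u ^ r * theta))], kept as explicit monomials so that
    their degrees in [theta] and [u] can be compared. *)
Definition exp_pow_deriv (r : nat) (theta : R) (j : nat) (u : R) : R :=
  eval_monos (Nat.iter j (derive_monos r) [(1, 0%nat, 0%nat)]) theta u
    * exp (- (u ^ r * theta)).

Lemma eval_monos_derive (r : nat) (l : list (R * nat * nat)) (theta u : R) :
  is_derive (fun v => eval_monos l theta v * exp (- (v ^ r * theta))) u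
    (eval_monos (derive_monos r l) theta u * exp (- (u ^ r * theta))).
Proof.
  induction l as [|[[c i] p] l IH]; simpl.
  - rewrite Rmult_0_l. apply is_derive_ext with (fun _ => 0).
    + intros t. symmetry. apply Rmult_0_l.
    + apply (is_derive_const (V := R_NormedModule)).
  - apply is_derive_ext with (fun v => c * theta ^ i * v ^ p * exp (- (v ^ r * theta))
      + eval_monos l theta v * exp (- (v ^ r * theta))).
    + intros t. symmetry. apply Rmult_plus_distr_r.
    + fold (derive_monos r l).
      replace ((_ + _) * _) with
        ((c * INR p * theta ^ i * u ^ pred p
          + - c * INR r * (theta * theta ^ i) * u ^ (p + pred r)) * exp (- (u ^ r * theta))
         + eval_monos (derive_monos r l) theta u * exp (- (u ^ r * theta))) by ring.
      apply (is_derive_plus (V := R_NormedModule)); [|exact IH].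
      auto_derive; [trivial|]. rewrite pow_add. ring.
Qed.

(* For [p = 0] the first monomial of the derivative has the wrong degree
   ([pred 0 = 0]) but coefficient [0]. *)
Lemma derive_monos_degree (r j : nat) (c : R) (i p : nat) :
  (0 < r)%nat ->
  In (c, i, p) (Nat.iter j (derive_monos r) [(1, 0%nat, 0%nat)]) ->
  c = 0 \/ (p + j = r * i)%nat.
Proof.
  intros Hr. revert c i p. induction j as [|j IH]; intros c i p Hin.
  - destruct Hin as [Heq|[]]. injection Heq as <- <- <-. right. lia.
  - apply in_flat_map in Hin. destruct Hin as [[[c' i'] p'] [Hin Heq]].
    apply IH in Hin. destruct Heq as [Heq|[Heq|[]]]; injection Heq as <- <- <-.
    + destruct Hin as [-> | Hin]; [left; ring|].
      destruct p' as [|p']; [left; simpl; ring | right; simpl; lia].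
    + destruct Hin as [-> | Hin]; [left; ring | right]. nia.
Qed.

(* Comparable to [1 / (1 + u)^2], but with a telescoping series. *)
Definition quad_decay (u : R) : R := / ((u + 1) * (u + 2)).

Lemma pow_exp_le_fact (k : nat) (v : R) : 0 <= v -> v ^ k * exp (- v) <= INR (fact k).
Proof.
  intros Hv. rewrite exp_Ropp.
  apply Rmult_le_reg_r with (exp v); [apply exp_pos|].
  rewrite Rmult_assoc, Rinv_l, Rmult_1_r by (apply Rgt_not_eq, exp_pos).
  assert (H : v ^ k / INR (fact k) <= exp v).
  { eapply Rle_trans; [|apply (exp_ge_taylor v k Hv)].
    destruct k as [|k]; [apply Rle_refl|]. simpl sum_f_R0.
    assert (0 <= sum_f_R0 (fun i => v ^ i / INR (fact i)) k).
    { apply cond_pos_sum. intros i. apply Rmult_le_pos; [now apply pow_le|].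
      apply Rlt_le, Rinv_0_lt_compat, INR_fact_lt_0. }
    simpl in *. lra. }
  apply (Rmult_le_compat_l (INR (fact k))) in H; [|apply pos_INR].
  replace (INR (fact k) * (v ^ k / INR (fact k))) with (v ^ k) in H
    by (field; apply INR_fact_neq_0).
  exact H.
Qed.

(** With [k = i - q], the factor [theta ^ q] is set aside and [p + 2 <= r k]. For [u > 1] the rest
    is controlled by [v ^ k * exp (- v) <= k!] at [v = u ^ r * theta]; for [u <= 1] every factor is
    at most 1. The 6 comes from [(u + 1) (u + 2)], at most 6 on [0, 1] and at most [6 u ^ 2]
    beyond. *)
Lemma mono_decay (r q i p : nat) (theta u : R) :
  (p + (r * q + 2) <= r * i)%nat -> 0 < theta < 1 -> 0 <= u ->
  theta ^ i * u ^ p * exp (- (u ^ r * theta))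
    <= 6 * INR (fact i) * theta ^ q * quad_decay u.
Proof.
  intros Hle Ht Hu.
  assert (Hq : (q < i)%nat) by nia.
  set (k := (i - q)%nat). replace i with (q + k)%nat at 1 by lia. rewrite pow_add.
  assert (Htq : 0 < theta ^ q) by (apply pow_lt; lra).
  assert (Htk : 0 < theta ^ k) by (apply pow_lt; lra).
  assert (Hv : 0 <= u ^ r * theta) by (apply Rmult_le_pos; [now apply pow_le|lra]).
  assert (Hfact : INR (fact k) <= INR (fact i)) by (apply le_INR, fact_le; lia).
  assert (Hfact1 : 1 <= INR (fact k)).
  { change 1 with (INR 1). apply le_INR, lt_O_fact. }
  set (E := exp (- (u ^ r * theta))).
  assert (HE : 0 < E) by apply exp_pos.
  assert (HE1 : E <= 1).
  { unfold E. rewrite exp_Ropp, <- Rinv_1. apply Rinv_le_contravar; [lra|].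
    pose proof (exp_ineq1_le (u ^ r * theta)). lra. }
  assert (Hup : 0 <= u ^ p) by now apply pow_le.
  assert (Hkey : theta ^ k * u ^ p * E * ((u + 1) * (u + 2)) <= 6 * INR (fact k)).
  { destruct (Rle_lt_dec u 1) as [Hu1|Hu1].
    - assert (Htk1 : theta ^ k <= 1) by (rewrite <- (pow1 k); apply pow_incr; lra).
      assert (Hup1 : u ^ p <= 1) by (rewrite <- (pow1 p); apply pow_incr; lra).
      assert (H1 : theta ^ k * u ^ p <= 1) by nra.
      assert (H2 : theta ^ k * u ^ p * E <= 1).
      { assert (0 <= theta ^ k * u ^ p) by (apply Rmult_le_pos; lra). nra. }
      assert (H3 : 0 <= theta ^ k * u ^ p * E)
        by (apply Rmult_le_pos; [apply Rmult_le_pos|]; lra).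
      nra.
    - apply Rle_trans with (6 * ((u ^ r * theta) ^ k * E)).
      + rewrite Rpow_mult_distr, <- pow_mult.
        assert (H1 : u ^ (p + 2) <= u ^ (r * k)) by (apply Rle_pow; [lra|nia]).
        rewrite pow_add in H1.
        assert (H2 : u ^ p * ((u + 1) * (u + 2)) <= 6 * u ^ (r * k)).
        { apply Rle_trans with (u ^ p * (6 * u ^ 2)); [|lra].
          apply Rmult_le_compat_l; [exact Hup|nra]. }
        replace (theta ^ k * u ^ p * E * ((u + 1) * (u + 2)))
          with (theta ^ k * E * (u ^ p * ((u + 1) * (u + 2)))) by ring.
        replace (6 * (u ^ (r * k) * theta ^ k * E))
          with (theta ^ k * E * (6 * u ^ (r * k))) by ring.
        apply Rmult_le_compat_l; [apply Rmult_le_pos; lra | exact H2].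
      + apply Rmult_le_compat_l; [lra|]. now apply pow_exp_le_fact. }
  unfold quad_decay.
  assert (Hpos : 0 < (u + 1) * (u + 2)) by nra.
  apply Rmult_le_reg_r with ((u + 1) * (u + 2)); [exact Hpos|].
  replace (theta ^ q * theta ^ k * u ^ p * E * ((u + 1) * (u + 2)))
    with (theta ^ q * (theta ^ k * u ^ p * E * ((u + 1) * (u + 2)))) by ring.
  replace (6 * INR (fact i) * theta ^ q * / ((u + 1) * (u + 2)) * ((u + 1) * (u + 2)))
    with (theta ^ q * (6 * INR (fact i))) by (field; lra).
  apply Rmult_le_compat_l; lra.
Qed.

Lemma exp_pow_deriv_decay (r q : nat) :
  (0 < r)%nat ->
  exists K, 0 <= K /\ forall theta u, 0 < theta < 1 -> 0 <= u ->
    Rabs (exp_pow_deriv r theta (r * q + 2) u) <= K * theta ^ q * quad_decay u.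
Proof.
  intros Hr. unfold exp_pow_deriv.
  (* The induction on the list retains only the degree relation, which for order [r q + 2] implies
     the hypothesis of [mono_decay]; the constants of the monomials add up. *)
  pose proof (fun c i p => derive_monos_degree r (r * q + 2) c i p Hr) as Hl.
  induction (Nat.iter (r * q + 2) (derive_monos r) [(1, 0%nat, 0%nat)])
    as [|[[c i] p] l IH].
  - exists 0. split; [lra|]. intros theta u _ _. simpl.
    rewrite !Rmult_0_l, Rabs_R0. lra.
  - destruct IH as [K [HK HB]]; [intros; apply Hl; now right|].
    exists (Rabs c * (6 * INR (fact i)) + K). split.
    { apply Rplus_le_le_0_compat; [|exact HK].
      apply Rmult_le_pos; [apply Rabs_pos|]. pose proof (pos_INR (fact i)). lra. }
    intros theta u Ht Hu. simpl. specialize (HB theta u Ht Hu).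
    set (E := exp (- (u ^ r * theta))) in *.
    replace ((c * theta ^ i * u ^ p + eval_monos l theta u) * E)
      with (c * (theta ^ i * u ^ p * E) + eval_monos l theta u * E) by ring.
    eapply Rle_trans; [apply Rabs_triang|]. rewrite Rabs_mult.
    rewrite !Rmult_plus_distr_r. apply Rplus_le_compat; [|exact HB].
    destruct (Hl c i p (or_introl eq_refl)) as [-> | Hd].
    + rewrite Rabs_R0. lra.
    + rewrite !(Rmult_assoc (Rabs c)). apply Rmult_le_compat_l; [apply Rabs_pos|].
      rewrite Rabs_pos_eq.
      * apply mono_decay; [lia|assumption..].
      * apply Rmult_le_pos; [apply Rmult_le_pos; apply pow_le; lra|].
        apply Rlt_le, exp_pos.
Qed.

Lemma exp_pow_half_diff_decay (r q : nat) (h : R) :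
  (0 < r)%nat -> 0 < h ->
  exists K, 0 <= K /\ forall theta u, 0 < theta < 1 -> 0 <= u ->
    Rabs (half_diff h (r * q + 2) (fun v => exp (- (v ^ r * theta))) u)
      <= K * theta ^ q * quad_decay u.
Proof.
  intros Hr Hh. destruct (exp_pow_deriv_decay r q Hr) as [K [HK HB]].
  assert (Hpow : 0 <= (h / 2) ^ (r * q + 2)) by (apply pow_le; lra).
  exists ((h / 2) ^ (r * q + 2) * K). split; [now apply Rmult_le_pos|].
  intros theta u Ht Hu.
  rewrite !Rmult_assoc, <- Rmult_assoc with (r1 := K).
  replace (half_diff h (r * q + 2) (fun v => exp (- (v ^ r * theta))) u)
    with (half_diff h (r * q + 2) (exp_pow_deriv r theta 0) u).
  - apply (half_diff_bound h (exp_pow_deriv r theta) Hh).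
    + intros i v. apply eval_monos_derive.
    + intros v Hv. eapply Rle_trans; [apply HB; lra|].
      apply Rmult_le_compat_l; [apply Rmult_le_pos; [exact HK | apply pow_le; lra]|].
      (* [quad_decay] decreases, so its value at [u] dominates on the whole half-line. *)
      unfold quad_decay. apply Rinv_le_contravar; nra.
  - clear. revert u. induction (r * q + 2)%nat as [|j IH]; intros u; simpl.
    + unfold exp_pow_deriv. simpl. ring.
    + now rewrite !IH.
Qed.

(** * Vanishing at infinity and telescoping series *)

Lemma exp_pow_lim (r : nat) (theta u : R) :
  (0 < r)%nat -> 0 < theta ->
  is_lim_seq (fun n => exp (- ((INR n + u) ^ r * theta))) 0.
Proof.
  intros Hr Ht.
  apply is_lim_seq_le_le_loc with (fun _ => 0) (fun n => / theta * / (INR n + u)).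
  (* Beyond [n0] one has [n + u >= 1], so the [r]-th power is at least [n + u], and [exp y >= 1 + y]
     gives the upper bound. *)
  - destruct (nfloor_ex (1 + Rabs u) ltac:(pose proof (Rabs_pos u); lra)) as [n0 Hn0].
    exists (S n0). intros n Hn. apply le_INR in Hn. rewrite S_INR in Hn.
    assert (Hnu : 1 <= INR n + u) by (pose proof (Rle_abs (- u)); rewrite Rabs_Ropp in *; lra).
    split; [apply Rlt_le, exp_pos|].
    rewrite exp_Ropp, <- Rinv_mult. apply Rinv_le_contravar; [nra|].
    eapply Rle_trans; [|apply exp_ineq1_le].
    assert (INR n + u <= (INR n + u) ^ r).
    { rewrite <- (pow_1 (INR n + u)) at 1. apply Rle_pow; [lra|lia]. }
    nra.
  - apply is_lim_seq_const.
  - replace (Finite 0) with (Rbar_mult (/ theta) (Rbar_inv p_infty))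
      by (simpl; f_equal; ring).
    apply is_lim_seq_scal_l, is_lim_seq_inv; [|discriminate].
    apply is_lim_seq_plus with p_infty u; [apply is_lim_seq_INR | apply is_lim_seq_const|].
    reflexivity.
Qed.

Lemma sum_f_R0_telescope (v : nat -> R) (n : nat) :
  sum_f_R0 v n - sum_f_R0 (fun k => v (S k)) n = v 0%nat - v (S n).
Proof. induction n as [|n IH]; simpl; lra. Qed.

(** A partial sum equals the first [S f'] values of [v] minus [S f'] consecutive later ones, a fixed
    number of terms that each tend to 0. *)
Lemma telescoping_series (f' : nat) (v : nat -> R) :
  is_lim_seq v 0 ->
  is_series (fun n => v n - v (n + S f')%nat) (sum_f_R0 v f').
Proof.
  intros Hv.
  assert (Hpart : forall n, sum_n (fun n => v n - v (n + S f')%nat) n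
      = sum_f_R0 v f' - sum_f_R0 (fun k => v (S (k + n))) f').
  { induction n as [|n IH].
    - rewrite sum_O.
      rewrite (sum_eq (fun k => v (S (k + 0))) (fun k => v (S k))).
      + symmetry. apply sum_f_R0_telescope.
      + intros. now rewrite Nat.add_0_r.
    - rewrite sum_Sn, IH. change plus with Rplus.
      pose proof (sum_f_R0_telescope (fun k => v (S (k + n))) f') as H.
      rewrite (sum_eq (fun k => v (S (k + S n))) (fun k => v (S (S k + n)))).
      + replace (S n + S f')%nat with (S (S f' + n)) by lia. simpl in *. lra.
      + intros. f_equal. lia. }
  change (is_lim_seq (sum_n (fun n => v n - v (n + S f')%nat)) (sum_f_R0 v f')).
  apply is_lim_seq_ext with (fun n =>
    sum_f_R0 v f' - sum_f_R0 (fun k => v (S (k + n))) f').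
  - intros n. symmetry. apply Hpart.
  - replace (Finite (sum_f_R0 v f')) with (Finite (sum_f_R0 v f' - 0)) by (f_equal; ring).
    apply is_lim_seq_minus'; [apply is_lim_seq_const|].
    assert (Hs : forall k, is_lim_seq (fun n => v (S (k + n))) 0).
    { intros k. apply is_lim_seq_ext with (fun n => v (n + S k)%nat).
      - intros n. f_equal. lia.
      - now apply is_lim_seq_incr_n. }
    clear Hpart. induction f' as [|f' IH]; simpl; [apply (Hs 0%nat)|].
    replace (Finite 0) with (Finite (0 + 0)) by (f_equal; ring).
    apply is_lim_seq_plus'; [exact IH | exact (Hs (S f'))].
Qed.

Lemma quad_decay_series (x : R) :
  0 <= x -> is_series (fun n => quad_decay (INR n + x)) (/ (x + 1)).
Proof.
  intros Hx.
  (* The step is 1 here, so the limit is a boundary sum with the single index 0. *)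
  replace (/ (x + 1)) with (sum_f_R0 (fun n => / (INR n + (x + 1))) 0)
    by (simpl; now rewrite Rplus_0_l).
  apply is_series_ext with (fun n => / (INR n + (x + 1)) - / (INR (n + 1) + (x + 1))).
  - intros n. unfold quad_decay. rewrite plus_INR. simpl (INR 1).
    pose proof (pos_INR n).
    change (/ (INR n + (x + 1)) - / (INR n + 1 + (x + 1))
      = / ((INR n + x + 1) * (INR n + x + 2)) :> R).
    field. lra.
  - apply (telescoping_series 0 (fun n => / (INR n + (x + 1)))).
    replace (Finite 0) with (Rbar_inv p_infty) by reflexivity.
    apply is_lim_seq_inv; [|discriminate].
    apply is_lim_seq_plus with p_infty (x + 1); [apply is_lim_seq_INR | apply is_lim_seq_const|].
    reflexivity.
Qed.

(** * The expansion for real antiperiodic coefficients *)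

Lemma Rabs_le_sum (a : nat -> R) (m n : nat) :
  (n <= m)%nat -> Rabs (a n) <= sum_f_R0 (fun k => Rabs (a k)) m.
Proof.
  intros Hn. induction Hn as [|m Hn IH].
  - destruct n as [|n]; [apply Rle_refl|]. simpl.
    pose proof (cond_pos_sum (fun k => Rabs (a k)) n (fun k => Rabs_pos (a k))). lra.
  - simpl. pose proof (Rabs_pos (a (S m))). lra.
Qed.

Lemma antiperiodic_bounded (a : nat -> R) (f' : nat) :
  (forall n, a (n + S f')%nat = - a n) -> exists A, 0 <= A /\ forall n, Rabs (a n) <= A.
Proof.
  intros Ha. exists (sum_f_R0 (fun m => Rabs (a m)) f').
  split; [apply cond_pos_sum; intros; apply Rabs_pos|].
  induction n as [n IH] using (well_founded_induction lt_wf).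
  destruct (le_lt_dec n f') as [Hn|Hn]; [now apply Rabs_le_sum|].
  replace n with ((n - S f') + S f')%nat by lia. rewrite Ha, Rabs_Ropp.
  apply IH. lia.
Qed.
Lemma alternating_sum_expansion (f' r N : nat) (x d : R) (a e : nat -> R) :
  (0 < r)%nat -> 0 <= x -> 0 < d ->
  (forall n, a (n + S f')%nat = - a n) ->
  (forall t, Rabs t < d ->
     is_pseries (fun n => e n / INR (fact n)) t (alt_gf a f' x t)) ->
  exists S : R -> R,
    (forall theta, 0 < theta < 1 ->
       is_series (fun n => a n * exp (- ((INR n + x) ^ r * theta))) (S theta)) /\
    bigO (N + 1) (fun theta => S theta
      - sum_f_R0 (fun n => (-1) ^ n * (e (r * n)%nat / 2) / INR (fact n) * theta ^ n) N).
Proof.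
  intros Hr Hx Hd Ha He.
  (* Of the [J] differences, [r * (N + 1)] yield the factor [theta ^ (N + 1)] and two more make the
     error summable over [n]. *)
  set (h := INR (S f')). set (J := (r * (N + 1) + 2)%nat).
  set (phi := fun theta v : R => exp (- (v ^ r * theta))).
  set (main := fun theta =>
    sum_f_R0 (fun m => a m * euler_sum h J (phi theta) (INR m + x)) f').
  set (err := fun theta n => a n * half_diff h J (phi theta) (INR n + x)).
  assert (Hh : 0 < h) by (apply lt_0_INR; lia).
  destruct (antiperiodic_bounded a f' Ha) as [A [HA HaA]].
  destruct (exp_pow_half_diff_decay r (N + 1) h Hr Hh) as [K [HK HB]].
  fold J in HB.
  pose proof (quad_decay_series x Hx) as Hq.
  assert (Herr : forall theta, 0 < theta < 1 -> forall n,
      Rabs (err theta n) <= A * (K * theta ^ (N + 1)) * quad_decay (INR n + x)).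
  { intros theta Ht n. unfold err. rewrite Rabs_mult, Rmult_assoc.
    apply Rmult_le_compat; try apply Rabs_pos; [apply HaA|].
    apply HB; [exact Ht|]. pose proof (pos_INR n). lra. }
  assert (Hexq : forall c, ex_series (fun n => c * quad_decay (INR n + x))).
  { intros c. apply (ex_series_scal (V := R_NormedModule) c (fun n => quad_decay (INR n + x))).
    eexists. exact Hq. }
  assert (Herr_abs : forall theta, 0 < theta < 1 ->
      ex_series (fun n => Rabs (err theta n))).
  { intros theta Ht.
    apply (ex_series_le (V := R_CompleteNormedModule) _
      (fun n => A * (K * theta ^ (N + 1)) * quad_decay (INR n + x))); [|apply Hexq].
    intros n. change (Rabs (Rabs (err theta n))
      <= A * (K * theta ^ (N + 1)) * quad_decay (INR n + x)).
    rewrite Rabs_Rabsolu. now apply Herr. }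
  exists (fun theta => main theta + Series (err theta)). split.
  - intros theta Ht.
    (* Antiperiodicity turns [euler_sum_shift] into a difference of two terms of one sequence,
       [S f'] apart. *)
    apply is_series_ext with (fun n =>
      (a n * euler_sum h J (phi theta) (INR n + x)
       - a (n + S f')%nat * euler_sum h J (phi theta) (INR (n + S f') + x)) + err theta n).
    + intros n. rewrite Ha, plus_INR. fold h.
      pose proof (euler_sum_shift h J (phi theta) (INR n + x)) as Hs.
      replace (INR n + h + x) with (INR n + x + h) by ring.
      change (a n * euler_sum h J (phi theta) (INR n + x)
        - - a n * euler_sum h J (phi theta) (INR n + x + h)
        + a n * half_diff h J (phi theta) (INR n + x) = a n * phi theta (INR n + x) :> R).
      apply (f_equal (Rmult (a n))) in Hs. lra.
    + apply (is_series_plus (V := R_NormedModule)).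
      * apply (telescoping_series f' (fun n => a n * euler_sum h J (phi theta) (INR n + x))).
        apply is_lim_seq_abs_0.
        apply is_lim_seq_le_le with (fun _ => 0)
          (fun n => A * Rabs (euler_sum h J (phi theta) (INR n + x))).
        -- intros n. split; [apply Rabs_pos|]. rewrite Rabs_mult.
           apply Rmult_le_compat_r; [apply Rabs_pos | apply HaA].
        -- apply is_lim_seq_const.
        -- replace (Finite 0) with (Rbar_mult A 0) by (simpl; f_equal; ring).
           apply is_lim_seq_scal_l.
           apply (is_lim_seq_abs_0 (fun n => euler_sum h J (phi theta) (INR n + x))).
           apply euler_sum_lim. intros u. now apply exp_pow_lim.
      * apply Series_correct, ex_series_Rabs. now apply Herr_abs.
  - apply bigO_ext with (fun theta => (main theta - sum_f_R0 (fun n =>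
        (-1) ^ n * (e (r * n)%nat / 2) / INR (fact n) * theta ^ n) N) + Series (err theta)).
    { intros theta. ring. }
    apply bigO_plus.
    (* The main part minus the claimed expansion is the transformation of the Taylor remainder of
       [phi] in [theta]. *)
    + apply bigO_ext with (fun theta => sum_f_R0 (fun m => a m *
        euler_sum h J (fun v => phi theta v
          - sum_f_R0 (fun k => (-1) ^ k * theta ^ k / INR (fact k) * v ^ (r * k)) N)
          (INR m + x)) f').
      * intros theta. unfold main.
        rewrite (sum_eq (fun n => (-1) ^ n * (e (r * n)%nat / 2) / INR (fact n) * theta ^ n)
          (fun k => sum_f_R0 (fun m => a m * ((-1) ^ k * theta ^ k / INR (fact k)
              * euler_sum h J (fun v => v ^ (r * k)) (INR m + x))) f')).
        -- rewrite <- (sum_f_R0_swap (fun m k => a m * ((-1) ^ k * theta ^ k / INR (fact k)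
              * euler_sum h J (fun v => v ^ (r * k)) (INR m + x)))), <- minus_sum.
           apply sum_eq. intros m _.
           rewrite euler_sum_minus,
             (euler_sum_sum h J (fun k => (-1) ^ k * theta ^ k / INR (fact k))
               (fun k v => v ^ (r * k))), Rmult_minus_distr_l.
           f_equal. rewrite scal_sum. apply sum_eq. intros k _. ring.
        -- intros k Hk.
           (* The number of differences is [J = S (r * (N + 1) + 1)], and [r * k <= r * N] stays
              within the range of exact coefficients. *)
           rewrite <- (euler_sum_coef f' (r * (N + 1) + 1) (r * k) x d a e Hd He) by nia.
           replace (S (r * (N + 1) + 1)) with J by (unfold J; lia). fold h.
           transitivity ((-1) ^ k * theta ^ k / INR (fact k) * sum_f_R0 (fun m => a m
             * euler_sum h J (fun v => v ^ (r * k)) (INR m + x)) f').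
           { unfold Rdiv. ring. }
           rewrite scal_sum. apply sum_eq. intros m _. ring.
      * apply bigO_sum. intros m. apply bigO_scal.
        apply (euler_sum_bigO h J (N + 1) (fun theta v => phi theta v
          - sum_f_R0 (fun k => (-1) ^ k * theta ^ k / INR (fact k) * v ^ (r * k)) N)).
        intros v. rewrite Nat.add_1_r.
        apply bigO_ext with (2 := exp_remainder (- v ^ r) N).
        intros theta. unfold phi. f_equal; [f_equal; ring|].
        apply sum_eq. intros k _.
        replace (- v ^ r) with ((-1) * v ^ r) by ring.
        rewrite Rpow_mult_distr, <- pow_mult. unfold Rdiv. ring.
    (* [A] bounds the coefficients, [K] the differences, and [/ (x + 1)] is the sum of the
       [quad_decay] series. *)
    + exists (A * K * / (x + 1)).
      generalize (at_right_0_lt 1 Rlt_0_1). apply filter_imp. intros theta Ht.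
      eapply Rle_trans; [apply Series_Rabs; now apply Herr_abs|].
      eapply Rle_trans.
      * apply Series_le with (b := fun n =>
          A * (K * theta ^ (N + 1)) * quad_decay (INR n + x)); [|apply Hexq].
        intros n. split; [apply Rabs_pos | now apply Herr].
      * rewrite Series_scal_l, (is_series_unique _ _ Hq). right. ring.
Qed.

(** * Passage from real to complex coefficients *)

(* The real argument is run on [Re] and [Im] of the coefficients separately. *)
Definition is_part (pr : C -> R) : Prop := pr = Re \/ pr = Im.

Lemma part_plus (pr : C -> R) (z w : C) : is_part pr -> pr (z + w)%C = pr z + pr w.
Proof. intros [-> | ->]; reflexivity. Qed.

Lemma part_minus (pr : C -> R) (z w : C) : is_part pr -> pr (z - w)%C = pr z - pr w.
Proof. intros [-> | ->]; reflexivity. Qed.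

Lemma part_scal (pr : C -> R) (s : R) (z : C) : is_part pr -> pr (RtoC s * z)%C = s * pr z.
Proof. intros [-> | ->]; [apply re_scal_l | apply im_scal_l]. Qed.

Lemma part_div (pr : C -> R) (s : R) (z : C) :
  is_part pr -> s <> 0 -> pr (z / RtoC s)%C = pr z / s.
Proof.
  intros Hpr Hs. unfold Cdiv. rewrite <- RtoC_inv, Cmult_comm, part_scal by assumption.
  apply Rmult_comm.
Qed.

Lemma part_sum_n (pr : C -> R) (z : nat -> C) (N : nat) :
  is_part pr -> pr (sum_n z N) = sum_f_R0 (fun k => pr (z k)) N.
Proof.
  intros Hpr. induction N as [|N IH].
  - now rewrite sum_O.
  - rewrite sum_Sn. simpl. rewrite <- IH. now apply part_plus.
Qed.

(** Balls in [C] are products of real balls, so convergence passes to each part. *)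
Lemma part_is_series (pr : C -> R) (z : nat -> C) (l : C) :
  is_part pr ->
  @is_series C_AbsRing C_NormedModule z l -> is_series (fun n => pr (z n)) (pr l).
Proof.
  intros Hpr Hz.
  apply (filterlim_ext (fun n => pr (sum_n z n))).
  - intros n. rewrite part_sum_n by exact Hpr. now rewrite sum_n_Reals.
  - apply filterlim_locally. intros eps.
    generalize (proj1 (filterlim_locally (U := C_UniformSpace) _ _) Hz eps).
    apply filter_imp. intros n [H1 H2]. destruct Hpr as [-> | ->]; assumption.
Qed.

Lemma C_is_series_of_parts (z : nat -> C) (l : C) :
  is_series (fun n => Re (z n)) (Re l) -> is_series (fun n => Im (z n)) (Im l) ->
  @is_series C_AbsRing C_NormedModule z l.
Proof.
  intros H1 H2. apply (filterlim_locally (U := C_UniformSpace)). intros eps.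
  pose proof (proj1 (filterlim_locally _ _) H1 eps) as H1'.
  pose proof (proj1 (filterlim_locally _ _) H2 eps) as H2'.
  generalize (filter_and _ _ H1' H2'). apply filter_imp. intros n [Ha Hb].
  rewrite sum_n_Reals, <- part_sum_n in Ha by (now left).
  rewrite sum_n_Reals, <- part_sum_n in Hb by (now right).
  split; assumption.
Qed.

Lemma CSeries_unique (z : nat -> C) (l : C) :
  @is_series C_AbsRing C_NormedModule z l -> CSeries z = l.
Proof.
  intros Hz. unfold CSeries. apply (iota_unique (V := C_CompleteNormedModule)); [|exact Hz].
  intros y Hy. exact (filterlim_locally_unique (V := C_NormedModule) _ _ _ Hy Hz).
Qed.

Lemma Cexp_RtoC (s : R) : Cexp (RtoC s) = RtoC (exp s).
Proof.
  unfold Cexp. simpl. rewrite cos_0, sin_0. change (1, 0) with (RtoC 1).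
  now rewrite Cmult_1_r.
Qed.

Lemma C_pow_n_RtoC (t : R) (n : nat) : pow_n (K := C_AbsRing) (RtoC t) n = RtoC (t ^ n).
Proof.
  induction n as [|n IH]; simpl; [reflexivity|].
  rewrite IH, RtoC_mult. reflexivity.
Qed.

(** The two conjugations cancel, and at real [t] everything but the character value is real, so [pr]
    acts on that value alone. *)
Lemma part_gen_euler_gf (pr : C -> R) (f' : nat) (chi : Z -> C) (x t : R) :
  is_part pr ->
  pr (gen_euler_gf (S f') (conj_char chi) x (RtoC t))
  = alt_gf (fun m => (-1) ^ m * pr (chi (Z.of_nat m))) f' x t.
Proof.
  intros Hpr. unfold gen_euler_gf, alt_gf.
  replace (S f' - 1)%nat with f' by lia.
  change (pr (sum_n (fun m => (2 * RtoC ((-1) ^ m)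
       * conj_char (conj_char chi) (Z.of_nat m)
       * Cexp ((RtoC (INR m) + RtoC x) * RtoC t)
       / (Cexp (RtoC (INR (S f')) * RtoC t) + 1))%C) f') = 
    sum_f_R0 (fun m => 2 * ((-1) ^ m * pr (chi (Z.of_nat m))) * exp ((INR m + x) * t)
       / (exp (INR (S f') * t) + 1)) f').
  rewrite part_sum_n by exact Hpr. apply sum_eq. intros m _.
  unfold conj_char. rewrite Cconj_conj.
  rewrite <- RtoC_plus, <- !RtoC_mult, !Cexp_RtoC, <- RtoC_plus.
  rewrite part_div by (try exact Hpr; pose proof (exp_pos (INR (S f') * t)); lra).
  rewrite (Cmult_comm _ (RtoC (exp _))), Cmult_assoc, <- RtoC_mult.
  rewrite part_scal by exact Hpr. unfold Rdiv. ring.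
Qed.

Lemma part_expansion (pr : C -> R) (f' r N : nat) (chi : Z -> C) (E : nat -> R -> C) (x : R) :
  is_part pr ->
  Nat.Even f' ->
  (forall m, chi (m + Z.of_nat (S f'))%Z = chi m) ->
  gen_euler_poly (S f') (conj_char chi) E ->
  (0 < r)%nat -> 0 <= x ->
  exists S : R -> R,
    (forall theta, 0 < theta < 1 ->
       is_series (fun n => (-1) ^ n * pr (chi (Z.of_nat n))
         * exp (- ((INR n + x) ^ r * theta))) (S theta)) /\
    bigO (N + 1) (fun theta => S theta
      - sum_f_R0 (fun n => (-1) ^ n * (pr (E (r * n)%nat x) / 2) / INR (fact n) * theta ^ n) N).
Proof.
  intros Hpr Hf Hchi HE Hr Hx.
  apply (alternating_sum_expansion f' r N x (PI / INR (S f'))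
    (fun n => (-1) ^ n * pr (chi (Z.of_nat n))) (fun n => pr (E n x)) Hr Hx).
  - apply Rdiv_lt_0_compat; [apply PI_RGT_0 | apply lt_0_INR; lia].
  (* The period [S f'] is odd, so the sign flips while [chi] repeats. *)
  - intros n. rewrite Nat2Z.inj_add, Hchi, pow_add.
    destruct Hf as [k ->]. rewrite pow_1_odd. ring.
  - intros t Ht. rewrite <- part_gen_euler_gf by exact Hpr.
    specialize (HE x (RtoC t)). rewrite Cmod_R in HE. specialize (HE Ht).
    apply (part_is_series pr _ _ Hpr) in HE.
    revert HE. apply is_series_ext. intros n.
    rewrite pow_n_pow, (C_pow_n_RtoC t n).
    change (pr (RtoC (t ^ n) * (E n x / RtoC (INR (fact n))))%C
      = t ^ n * (pr (E n x) / INR (fact n))).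
    rewrite part_scal, part_div by (exact Hpr || apply INR_fact_neq_0). reflexivity.
Qed.

Lemma Cmod_le_parts (z : C) : Cmod z <= Rabs (Re z) + Rabs (Im z).
Proof.
  replace z with (RtoC (Re z) + Ci * RtoC (Im z))%C at 1.
  - eapply Rle_trans; [apply Cmod_triangle|].
    rewrite Cmod_mult, !Cmod_R, Cmod_Ci. lra.
  - destruct z as [p q]. unfold Re, Im, Ci, RtoC, Cplus, Cmult. simpl. f_equal; ring.
Qed.

(** * Recombination of the real and imaginary expansions *)

Theorem theorem1p2 (f : nat) (chi : Z -> C) (E : nat -> R -> C) (r : nat) (b : R) :
  Nat.Odd f ->
  primitive_char f chi ->
  nonprincipal chi ->
  gen_euler_poly f (conj_char chi) E ->
  (0 < r)%nat ->
  0 <= b < INR r ->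
  forall N : nat,
  exists M : R,
    at_right 0 (fun theta : R =>
      Cmod (G1 chi theta b r
            - RtoC (INR r / 2)
              * sum_n (fun n : nat =>
                  RtoC ((-1) ^ n) * E (r * n)%nat (b / INR r)%R%R
                  / RtoC (INR (fact n)) * RtoC (theta ^ n)) N)%C
      <= M * theta ^ (N + 1)).
Proof.
  intros Hf [Hchi _] _ HE Hr Hb N.
  destruct f as [|f']; [destruct Hf; lia|].
  assert (Hf' : Nat.Even f') by (now apply Nat.Odd_succ).
  assert (HrR : 0 < INR r) by (apply lt_0_INR; exact Hr).
  set (x := b / INR r).
  assert (Hx : 0 <= x).
  { apply Rmult_le_pos; [lra|]. now apply Rlt_le, Rinv_0_lt_compat. }
  pose proof (dchar_periodic _ _ Hchi) as Hper.
  destruct (part_expansion Re f' r N chi E x (or_introl eq_refl) Hf' Hper HE Hr Hx)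
    as [S1 [HS1 HO1]].
  destruct (part_expansion Im f' r N chi E x (or_intror eq_refl) Hf' Hper HE Hr Hx)
    as [S2 [HS2 HO2]].
  destruct HO1 as [K1 HK1]. destruct HO2 as [K2 HK2].
  (* The modulus is at most the sum of the absolute values of the two parts, and [G1] carries the
     prefactor [r]. *)
  exists (INR r * (K1 + K2)).
  generalize (filter_and _ _ (filter_and _ _ HK1 HK2) (at_right_0_lt 1 Rlt_0_1)).
  apply filter_imp. intros theta [[H1 H2] Ht].
  set (T := sum_n (fun n : nat => RtoC ((-1) ^ n) * E (r * n)%nat x
                  / RtoC (INR (fact n)) * RtoC (theta ^ n))%C N).
  (* Both real series converge for [0 < theta < 1], so [CSeries] is a genuine sum here. *)
  assert (HG : G1 chi theta b r = (RtoC (INR r) * (S1 theta, S2 theta))%C).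
  { unfold G1. f_equal. apply CSeries_unique.
    apply C_is_series_of_parts.
    - generalize (HS1 theta Ht). apply is_series_ext. intros n. fold x.
      rewrite re_scal_r, re_scal_l. reflexivity.
    - generalize (HS2 theta Ht). apply is_series_ext. intros n. fold x.
      rewrite im_scal_r, im_scal_l. reflexivity. }
  assert (HT : forall pr, is_part pr -> / 2 * pr T = sum_f_R0 (fun n =>
      (-1) ^ n * (pr (E (r * n)%nat x) / 2) / INR (fact n) * theta ^ n) N).
  { intros pr Hpr. unfold T. rewrite part_sum_n, scal_sum by exact Hpr.
    apply sum_eq. intros n _.
    rewrite Cmult_comm, part_scal, part_div, part_scal
      by (exact Hpr || apply INR_fact_neq_0).
    unfold Rdiv. ring. }
  rewrite <- HT in H1 by (now left). rewrite <- HT in H2 by (now right).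
  rewrite HG.
  replace (RtoC (INR r) * (S1 theta, S2 theta) - RtoC (INR r / 2) * T)%C
    with (RtoC (INR r) * ((S1 theta, S2 theta) - RtoC (/ 2) * T))%C.
  2:{ unfold Rdiv. rewrite RtoC_mult. ring. }
  rewrite Cmod_mult, Cmod_R, Rabs_pos_eq, Rmult_assoc by lra.
  apply Rmult_le_compat_l; [lra|].
  eapply Rle_trans; [apply Cmod_le_parts|].
  rewrite (part_minus Re), (part_minus Im), (part_scal Re), (part_scal Im)
    by ((now left) || (now right)).
  simpl (Re (_, _)). simpl (Im (_, _)). lra.
Qed.
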